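(* Let $n>2$ and assume $\mathrm{D}_{2n}$ is a DCI-group. Then the number of isomorphism classes of Cayley digraphs on $\mathrm{D}_{2n}$ equals \[\mathsf{o}\big(2^{\mathrm{D}_{2n}\setminus\{1\}},\mathrm{Aut}(\mathrm{D}_{2n})\big)=\frac{1}{n\phi(n)}\sum_{t>0,\ t\mid n}\phi\!\left(\frac{n}{t}\right)\sum_{\substack{1\le r\le n-1\\ \gcd(r,n)=1}}2^{\,\mathsf{c}(U_n,a_{n,r,0})+\mathsf{c}(V_n,a_{n,r,t})},\] where $\mathsf{c}(U_n,a_{n,r,0})=\sum_{d>1,\,d\mid n}\phi(d)/|r|_d$ and $\mathsf{c}(V_n,a_{n,r,t})=\sum_{(d,\ell)}\frac{d}{\kappa(n,r,t)}\phi\!\left(\frac{|r|_n}{\ell\gcd(\kappa(d,r,t),|r|_n)}\right)$, the latter sum over pairs of positive integers $(d,\ell)$ with $d\mid n$, $\ell\mid\frac{|r|_n}{\gcd(\kappa(d,r,t),|r|_n)}$ and $\gcd(r^{\ell\kappa(d,r,t)}-1,n)=d$.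
   Context: For a finite group $R$ and $S\subseteq R\setminus\{1\}$, the Cayley digraph $\mathrm{Cay}(R,S)$ has vertex set $R$ and arcs $x\to sx$ for $x\in R$, $s\in S$. $R$ is a DCI-group if whenever $\mathrm{Cay}(R,S)\cong\mathrm{Cay}(R,T)$ for $S,T\subseteq R\setminus\{1\}$, there is $\sigma\in\mathrm{Aut}(R)$ with $S^\sigma=T$. ''Number of isomorphism classes of Cayley digraphs on $R$'' means the number of isomorphism classes among $\{\mathrm{Cay}(R,S):S\subseteq R\setminus\{1\}\}$; $\mathsf{o}(2^{R\setminus\{1\}},\mathrm{Aut}(R))$ is the number of orbits of $\mathrm{Aut}(R)$ on subsets of $R\setminus\{1\}$. $\mathrm{D}_{2n}=\langle u_n,v_n\mid u_n^n=1=v_n^2,\ v_nu_nv_n=u_n^{-1}\rangle$; for $\gcd(r,n)=1$, $a_{n,r,t}$ is the automorphism with $u_n^i\mapsto u_n^{ri}$, $u_n^jv_n\mapsto u_n^{rj+t}v_n$. $U_n:=\langle u_n\rangle\setminus\{1\}$, $V_n:=\{u_n^iv_n:0\le i\le n-1\}$; $\mathsf{c}(\Omega,a)$ is the number of cycles (including fixed points) of $a$ on $\Omega$. $|r|_m$ is the multiplicative order of $r$ mod $m$ ($|r|_1=1$); $S_k(x)=1+x+\cdots+x^{k-1}$, $S_0=0$; $\kappa(m,r,t)=\dfrac{m|r|_m}{\gcd(m,tS_{|r|_m}(r))}$; $\phi$ is Euler's function. *)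

(* Defs.v *)
From HB Require Import structures.
From mathcomp Require Import all_boot all_order all_algebra all_fingroup.
From mathcomp Require Import ring.
Set Implicit Arguments.
Unset Strict Implicit.
Unset Printing Implicit Defensive.
Import GRing.Theory.

(* The dihedral group D_{2n} = < u, v | u^n = v^2 = 1, v u v = u^-1 >.       *)
(* The element (i, b) represents u^i v^b (i in Z/nZ, b = true iff v occurs). *)
(* ('Z_n is Z/nZ for n >= 2; the theorem below assumes n > 2.)              *)
Definition dih (n : nat) := ('Z_n * bool)%type.
HB.instance Definition _ n := Finite.on (dih n).

Section DihGroup.
Variable n : nat.
Local Open Scope ring_scope.

Definition dih_mul (x y : dih n) : dih n :=
  (x.1 + (if x.2 then - y.1 else y.1), x.2 (+) y.2).
Definition dih_one : dih n := (0, false).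
Definition dih_inv (x : dih n) : dih n := (if x.2 then x.1 else - x.1, x.2).

Lemma dih_mulA : associative dih_mul.
Proof.
move=> [i a] [j b] [k c]; rewrite /dih_mul /=.
by case: a; case: b; case: c => /=; congr pair; ring.
Qed.

Lemma dih_mul1 : left_id dih_one dih_mul.
Proof. by move=> [j b]; rewrite /dih_mul /= add0r. Qed.

Lemma dih_mulV : left_inverse dih_one dih_inv dih_mul.
Proof. by move=> [i a]; rewrite /dih_mul /dih_one /=; case: a => /=; congr pair; ring. Qed.
End DihGroup.

HB.instance Definition _ n :=
  Finite_isGroup.Build (dih n) (@dih_mulA n) (@dih_mul1 n) (@dih_mulV n).

Section DihElements.
Variable n : nat.
Local Open Scope ring_scope.
Definition dih_u : dih n := (1, false).
Definition dih_v : dih n := (0, true).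
Definition dih_a (r t : nat) (x : dih n) : dih n :=
  (r%:R * x.1 + (if x.2 then t%:R else 0), x.2).
Definition dih_U : {set dih n} := [set x : dih n | (x.2 == false) && (x.1 != 0)].
Definition dih_V : {set dih n} := [set x : dih n | x.2].
End DihElements.

Definition ncycles (T : finType) (Omega : {set T}) (a : T -> T) : nat :=
  fcard a Omega.

Section Cayley.
Variable gT : finGroupType.
Local Open Scope group_scope.

Definition cay_arc (S : {set gT}) (x y : gT) : bool := [exists s in S, y == s * x].

Definition cay_iso (S T : {set gT}) : bool :=
  [exists f : {perm gT}, [forall x, forall y, cay_arc S x y == cay_arc T (f x) (f y)]].

Definition conn_sets : {set {set gT}} := powerset (~: [set 1]).

Definition DCI_group : Prop :=
  forall S T : {set gT}, S \in conn_sets -> T \in conn_sets ->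
    cay_iso S T -> exists2 sigma, sigma \in Aut [set: gT] & sigma @: S = T.

Definition n_cay_classes : nat :=
  #|[set [set T in conn_sets | cay_iso S T] | S : {set gT} in conn_sets]|.

Definition n_aut_orbits : nat :=
  #|[set [set (sigma : {perm gT}) @: S | sigma in Aut [set: gT]] | S : {set gT} in conn_sets]|.
End Cayley.

(* |r|_m: least k >= 1 with r^k = 1 (mod m) (searched in 1..m; for r coprime *)
(* to m >= 1 it exists there).  |r|_1 = 1.                                    *)
Definition mord (m r : nat) : nat :=
  head 0 [seq k <- iota 1 m | r ^ k == 1 %[mod m]].

Definition Ssum (k x : nat) : nat := \sum_(i < k) x ^ i.

Definition kappa (m r t : nat) : nat :=
  (m * mord m r) %/ gcdn m (t * Ssum (mord m r) r).

(* Main.v *)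
(* The number of orbits of Aut(D_2n) on connection sets is computed by Burnside's
   lemma: for n > 2 the automorphisms are exactly the maps a_{n,r,t}, and the
   number of subsets invariant under a is 2 to the number of cycles of a.
   On U_n the point u^x of order d lies in a cycle of length |r|_d.  On V_n the
   power a^k is the affine map j |-> r^k j + t S_k(r), which has
   d = gcd(r^k - 1, n) fixed points if d | t S_k(r), i.e. if kappa(d) | k, and none
   otherwise; averaging over k < kappa(n) and sorting by d gives the cycle count.
   The multiples kappa(d) j of kappa(d) below kappa(n) are then sorted by
   l = gcd(j, M), where M = |r|_n / gcd(kappa(d), |r|_n): whenever d contributes at
   all, kappa(n) = lcm(kappa(d), |r|_n), so that j runs over exactly M residues.
   Finally the cycle count depends on t only through gcd(t, n), which groups the
   sum over t in Z/n into a sum over divisors. *)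
Require Import Defs.
From mathcomp Require Import all_boot all_order all_algebra all_fingroup.
From mathcomp Require Import cyclic.
Import GRing.Theory.
Local Open Scope ring_scope.

(** * Cycles of an injective self-map of a finite type *)

Lemma iter_eq_dvd_order (T : finType) (f : T -> T) (x : T) (k : nat) :
  injective f -> (iter k f x == x) = (fingraph.order f x %| k)%N.
Proof.
move=> injf; rewrite {1}(divn_eq k (fingraph.order f x)) addnC iterD.
have -> : iter (k %/ fingraph.order f x * fingraph.order f x) f x = x.
  by elim: (k %/ _)%N => //= m IH; rewrite mulSn iterD IH iter_order.
rewrite /dvdn; set i := (k %% _)%N.
apply/eqP/eqP => [ix | -> //].
have lti : (i < fingraph.order f x)%N by rewrite ltn_mod fingraph.order_gt0.
by rewrite -(findex_iter lti) ix findex0.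
Qed.

(** Each point is weighted by the inverse of its cycle length, so every cycle contributes exactly 1.
    This turns cycle counting into a sum over points. *)
Lemma fcard_sum_order (T : finType) (f : T -> T) (A : {set T}) :
  injective f -> fclosed f A ->
  (fcard f A)%:R = \sum_(x in A) (fingraph.order f x)%:R^-1 :> rat.
Proof.
move=> injf clA; have symf := fconnect_sym injf.
rewrite (partition_big (froot f) (fun y => froots f y && (y \in A))) /=; last first.
  move=> x xA; rewrite (roots_root symf) /=.
  by rewrite -(closed_connect clA (connect_root (frel f) x)).
rewrite /n_comp_mem -sum1_card natr_sum; apply: eq_bigr => y.
rewrite inE => /andP[/eqP ry yA].
(* The fibre of [froot f] over a root [y] in [A] is the whole cycle of [y]. *)
have Ey x : (x \in A) && (froot f x == y) = fconnect f y x.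
  rewrite -{1}ry (root_connect symf) symf; case: (boolP (fconnect f y x)) => yx.
    by rewrite -(closed_connect clA yx) andbT; exact: yA.
  by rewrite andbF.
rewrite (eq_bigl _ _ Ey).
rewrite (eq_bigr (fun _ => (fingraph.order f y)%:R^-1)); last first.
  move=> x yx; congr (_%:R^-1); apply: eq_card => z.
  by rewrite !inE (same_connect symf yx).
rewrite sumr_const -[#|_|]/(fingraph.order f y) -[RHS]mulr_natr mulVf //.
by rewrite Num.Theory.pnatr_eq0 -lt0n fingraph.order_gt0.
Qed.

(** An invariant subset is a union of cycles, hence is determined by the canonical roots it
    contains, and these can be chosen freely among the roots in [A]. *)
Lemma card_invariant_subsets (T : finType) (f : T -> T) (A : {set T}) :
  injective f -> fclosed f A ->
  #|[set S in powerset A | f @: S == S]| = (2 ^ fcard f A)%N.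
Proof.
move=> injf clA; have symf := fconnect_sym injf.
set rA := [set x in A | froots f x].
have -> : fcard f A = #|rA|.
  by apply: eq_card => x; rewrite !inE andbC.
rewrite -card_powerset.
have imP (S : {set T}) : f @: S = S -> fclosed f S.
  by move=> fS x _ /eqP <-; rewrite -{2}fS (mem_imset _ _ injf).
have clP (S : {set T}) : fclosed f S -> f @: S = S.
  move=> clS; apply/eqP; rewrite eqEcard card_imset // leqnn andbT.
  by apply/subsetP => _ /imsetP[x xS ->]; rewrite -(clS x (f x)) //=.
(* The union of the cycles whose root lies in [R]; it inverts [S] |-> [S :&: rA]. *)
pose ext (R : {set T}) := [set x | froot f x \in R].
have clext R : fclosed f (ext R).
  move=> x y xy; rewrite !inE; congr (_ \in R); apply/eqP.
  by rewrite (root_connect symf) (connect1 xy).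
rewrite -[RHS](card_in_imset (f := ext)) => [|R1 R2]; last first.
  rewrite !powersetE => /subsetP s1 /subsetP s2 /setP E; apply/setP => x.
  have := E x; rewrite !inE => Ex.
  case rx: (froots f x); first by move: Ex; rewrite (eqP rx).
  apply/idP/idP => [/s1|/s2]; by rewrite inE rx andbF.
congr #|pred_of_set _|; apply/setP => S; rewrite inE powersetE.
apply/andP/imsetP => [[/subsetP sSA /eqP fS] | [R]].
  exists (S :&: rA).
    by rewrite powersetE subsetIr.
  apply/setP => x; rewrite !inE (roots_root symf) andbT.
  rewrite -(closed_connect (imP _ fS) (connect_root (frel f) x)).
  by case xS: (x \in S) => //=; rewrite -(closed_connect clA (connect_root (frel f) x)) sSA.
rewrite powersetE => /subsetP sR ->; split; last by rewrite clP.
apply/subsetP => x; rewrite inE => /sR; rewrite inE => /andP[].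
by rewrite -(closed_connect clA (connect_root (frel f) x)).
Qed.

(** * Sums sorted by gcd, and linear congruences *)

Local Open Scope nat_scope.

Lemma sum_multiples (g m : nat) (F : nat -> nat) :
  0 < g -> \sum_(x < g * m | g %| x) F x = \sum_(y < m) F (g * y).
Proof.
move=> g0; rewrite -(big_mkord (fun x => g %| x)) -(big_mkord xpredT (fun y => F (g * y))).
elim: m => [|m IH]; first by rewrite muln0 !big_geq.
rewrite big_nat_recr //= -IH mulnS addnC.
rewrite (big_cat_nat (n := g * m)) ?leq_addr //=; congr (_ + _).
rewrite -{1}[g * m]add0n big_addn addKn big_ltn_cond // add0n dvdn_mulr //.
rewrite [X in _ + X]big_nat_cond big_pred0 ?addn0 // => i.
apply/negP => /andP[/andP[i0 ig]]; rewrite dvdn_addl ?dvdn_mulr // => /dvdn_leq.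
by rewrite i0 leqNgt ig => /(_ isT).
Qed.

(** Writing x = d y turns gcd(x, n) = d into y being coprime to n / d. *)
Lemma card_gcdn_eq (n d : nat) :
  0 < n -> d %| n -> \sum_(x < n) (gcdn x n == d) = totient (n %/ d).
Proof.
move=> n0 dn; have d0 := dvdn_gt0 n0 dn.
have m0 : 0 < n %/ d by rewrite divn_gt0 // dvdn_leq.
rewrite (bigID (fun x : 'I_n => d %| x)) /= [X in _ + X]big1 ?addn0; last first.
  by move=> x; case: eqP => // <-; rewrite dvdn_gcdl.
have -> : \sum_(x < n | d %| x) (gcdn x n == d) =
          \sum_(x < d * (n %/ d) | d %| x) (gcdn x n == d).
  by rewrite [d * _]mulnC divnK.
rewrite (sum_multiples _ _ (fun x => nat_of_bool (gcdn x n == d))) //.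
rewrite totient_count_coprime big_mkord; apply: eq_bigr => y _.
have -> : gcdn (d * y) n = d * gcdn y (n %/ d).
  by rewrite muln_gcdr [d * (n %/ d)]mulnC divnK.
have := @eqn_pmul2l d (gcdn y (n %/ d)) 1 d0; rewrite muln1 => ->.
by rewrite gcdnC.
Qed.

Lemma sum_gcdn (R : pzSemiRingType) (n : nat) (F : nat -> R) :
  0 < n ->
  (\sum_(x < n) F (gcdn x n) =
   \sum_(d <- divisors n) (totient (n %/ d))%:R * F d)%R.
Proof.
move=> n0.
transitivity (\sum_(d <- divisors n) \sum_(x < n) (gcdn x n == d)%:R * F d)%R.
  rewrite exchange_big; apply: eq_bigr => x _ /=.
  rewrite (bigD1_seq (gcdn x n)) ?divisors_uniq -?dvdn_divisors ?dvdn_gcdr //=.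
  rewrite eqxx mul1r big1_seq ?addr0 // => d /andP[/negPf dx _].
  by rewrite eq_sym dx mul0r.
apply: eq_big_seq => d; rewrite -dvdn_divisors // => dn.
by rewrite -big_distrl -natr_sum card_gcdn_eq.
Qed.

(** The map j |-> a j + b permutes the residues mod n, so exactly one j is sent to 0. *)
Lemma card_linear_coprime (n a b : nat) :
  0 < n -> coprime a n -> \sum_(j < n) (n %| a * j + b) = 1.
Proof.
move=> n0 an.
pose h (j : 'I_n) : 'I_n := Ordinal (ltn_pmod (a * j + b) n0).
have injh : injective h.
  move=> i j /(congr1 val) /= /eqP; rewrite eqn_modDr => ij.
  (* Natural subtraction is truncated, so the difference is taken for an ordered pair and the other
     order follows by symmetry. *)
  have H: forall x y : 'I_n, x <= y -> a * x == a * y %[mod n] -> x = y.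
    move=> x y xy; rewrite eq_sym eqn_mod_dvd ?leq_mul2l ?xy ?orbT // -mulnBr.
    rewrite Gauss_dvdr 1?coprime_sym // -eqn_mod_dvd // !modn_small // => /eqP/esym E.
    exact: val_inj.
  case: (leqP i j) => [ij'|/ltnW ij']; first exact: H ij.
  by apply/esym/H => //; rewrite eq_sym.
have [g hK gK] := injF_bij injh.
rewrite (bigD1 (g (Ordinal n0))) //= big1 => [|j].
  by have /(congr1 val) /= := gK (Ordinal n0); rewrite /dvdn => ->.
move=> jn; apply/eqP; rewrite eqb0; apply: contra jn => /eqP E; apply/eqP.
by rewrite -[LHS]hK; congr g; apply: val_inj.
Qed.

Lemma sum_periodic (d m : nat) (F : nat -> nat) :
  (forall i j, F (i * m + j) = F j) ->
  \sum_(k < d * m) F k = d * \sum_(k < m) F k.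
Proof.
move=> per; rewrite -!(big_mkord xpredT F).
elim: d => [|d IH]; first by rewrite big_geq.
rewrite mulSnr mulSn (big_cat_nat (n := d * m)) ?leq_addr //= IH addnC; congr (_ + _).
rewrite -{1}[d * m]add0n big_addn addKn; apply: eq_bigr => i _.
by rewrite addnC per.
Qed.

(** A solution forces d | b. Dividing by d leaves a coprime congruence mod n / d with one solution
    per period, and [0, n) holds d periods. *)
Lemma card_linear_congruence (n a b : nat) :
  0 < n ->
  \sum_(j < n) (n %| a * j + b) = if gcdn a n %| b then gcdn a n else 0.
Proof.
move=> n0; set d := gcdn a n.
have d0 : 0 < d by rewrite gcdn_gt0 n0 orbT.
have [da dn] : d %| a /\ d %| n by rewrite dvdn_gcdl dvdn_gcdr.
case: ifPn => [db | ndb]; last first.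
  rewrite big1 // => j _; apply/eqP; rewrite eqb0; apply: contra ndb => H.
  by rewrite -(dvdn_addr b (dvdn_mulr j da)) (dvdn_trans dn H).
have m0 : 0 < n %/ d by rewrite divn_gt0 // dvdn_leq.
have co : coprime (a %/ d) (n %/ d).
  by rewrite /coprime -(eqn_pmul2l d0) muln_gcdr muln1 ![d * _]mulnC !divnK.
have E j : (n %| a * j + b) = (n %/ d %| a %/ d * j + b %/ d).
  rewrite -[RHS](@dvdn_pmul2l d) // mulnDr mulnA [d * (n %/ d)]mulnC [d * (a %/ d)]mulnC.
  by rewrite [d * (b %/ d)]mulnC !divnK.
rewrite (eq_bigr (fun j : 'I_n => nat_of_bool (n %/ d %| a %/ d * j + b %/ d)))
  => [|j _]; last by rewrite E.
have -> : \sum_(j < n) (n %/ d %| a %/ d * j + b %/ d) =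
          \sum_(j < d * (n %/ d)) (n %/ d %| a %/ d * j + b %/ d).
  by rewrite [d * _]mulnC divnK.
rewrite (sum_periodic _ _ (fun j => nat_of_bool (n %/ d %| a %/ d * j + b %/ d))).
  by rewrite card_linear_coprime // muln1.
move=> i j; congr nat_of_bool.
by rewrite mulnDr -addnA dvdn_addr // mulnA dvdn_mull.
Qed.

(** * Multiplicative orders, geometric sums and [kappa] *)

Section MultiplicativeOrder.
Variables m r : nat.
Hypotheses (m_gt0 : 0 < m) (r_gt0 : 0 < r) (co_rm : coprime r m).

Lemma eq_exp_mod1 k : (r ^ k == 1 %[mod m]) = (m %| r ^ k - 1).
Proof. by rewrite eqn_mod_dvd // expn_gt0 r_gt0. Qed.

Lemma mord_least :
  [/\ 0 < mord m r, r ^ mord m r = 1 %[mod m]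
    & forall k, 0 < k -> r ^ k = 1 %[mod m] -> mord m r <= k].
Proof.
rewrite /mord; set P := fun k => _ == _; set s := iota 1 m.
have hasP : has P s.
  apply/hasP; exists (totient m); last by apply/eqP/Euler_exp_totient.
  rewrite mem_iota totient_gt0 m_gt0 add1n ltnS totient_count_coprime.
  rewrite -[X in _ <= X]subn0 -[X in _ <= X]muln1 -sum_nat_const_nat leq_sum //.
  by move=> i _; case: coprime.
have sz : find P s < m by rewrite -[X in _ < X](size_iota 1) -has_find.
(* The list starts at 1, so its entry at position [find P s] is the successor of that position. *)
have -> : head 0 [seq k <- s | P k] = (find P s).+1.
  have -> : (find P s).+1 = nth 0 s (find P s) by rewrite nth_iota.
  by elim: (s) hasP => //= x s' IH; case: ifP => //= _ /IH.
split=> //.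
  by have /eqP := nth_find 0 hasP; rewrite nth_iota.
case=> // k _ /eqP Pk; rewrite ltnS leqNgt; apply/negP => lt_k.
have := before_find 0 lt_k; rewrite nth_iota ?(ltn_trans lt_k) // add1n.
by rewrite /P Pk.
Qed.

Lemma mord_gt0 : 0 < mord m r. Proof. by case: mord_least. Qed.

Lemma mord_dvd k : (mord m r %| k) = (m %| r ^ k - 1).
Proof.
have [o0 ro leo] := mord_least; set o := mord m r in o0 ro leo *.
rewrite -eq_exp_mod1 {2}(divn_eq k o) expnD [_ * o]mulnC expnM.
rewrite -modnMml -modnXm ro modnXm exp1n modnMml mul1n /dvdn.
apply/eqP/eqP => [->//|E].
have : k %% o < o by rewrite ltn_mod.
by case: (k %% o) E => // i /(leo _ (ltn0Sn i)); rewrite leqNgt => /negPf ->.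
Qed.

End MultiplicativeOrder.

Lemma mord_dvdn d m r :
  0 < m -> 0 < r -> coprime r m -> d %| m -> mord d r %| mord m r.
Proof.
move=> m0 r0 co dm; have d0 := dvdn_gt0 m0 dm.
rewrite mord_dvd ?(coprime_dvdr dm) // (dvdn_trans dm) //.
by rewrite -mord_dvd.
Qed.

Lemma SsumE r k : 0 < r -> r ^ k - 1 = (r - 1) * Ssum k r.
Proof. by move=> r0; rewrite /Ssum !subn1 predn_exp. Qed.

(** The sum splits into q blocks of length k, the i-th being r^(k i) times the first. *)
Lemma SsumM r k q : Ssum (k * q) r = Ssum k r * Ssum q (r ^ k).
Proof.
elim: q => [|q IH]; first by rewrite muln0 /Ssum !big_ord0 muln0.
rewrite /Ssum in IH *.
rewrite big_ord_recr /= mulnDr -IH mulnSr big_split_ord /=; congr (_ + _).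
rewrite big_distrl /=; apply: eq_bigr => i _.
by rewrite expnD expnM mulnC.
Qed.

Lemma Ssum_mod1 m x q : x = 1 %[mod m] -> Ssum q x = q %[mod m].
Proof.
move=> x1; rewrite /Ssum -modn_summ (eq_bigr (fun=> 1 %% m)); last first.
  by move=> i _; rewrite -modnXm x1 modnXm exp1n.
by rewrite modn_summ sum1_card card_ord.
Qed.

(** This identifies [kappa m r t] as the order of j |-> r j + t on Z/m, whose k-th power is j |->
    r^k j + t S_k(r). For k = o q with o = |r|_m, S_k(r) = S_o(r) S_q(r^o) is congruent to q S_o(r),
    so the second condition says that m / gcd(m, t S_o(r)) divides q. *)
Lemma kappa_dvd m r t k :
  0 < m -> 0 < r -> coprime r m ->
  (kappa m r t %| k) = (m %| r ^ k - 1) && (m %| t * Ssum k r).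
Proof.
move=> m0 r0 co; rewrite /kappa; set o := mord m r; set g := gcdn m _.
have o0 : 0 < o by apply: mord_gt0.
have g0 : 0 < g by rewrite gcdn_gt0 m0.
have gm : g %| m by apply: dvdn_gcdl.
have gS : g %| t * Ssum o r by apply: dvdn_gcdr.
have -> : m * o %/ g = o * (m %/ g) by rewrite mulnC muln_divA.
rewrite -mord_dvd //; case: (boolP (o %| k)) => [/dvdnP[q ->] | nok] /=; last first.
  by apply: contraNF nok; apply: dvdn_trans; rewrite dvdn_mulr.
rewrite mulnC dvdn_pmul2r // [q * o]mulnC SsumM mulnA.
have ro : r ^ o = 1 %[mod m] by apply/eqP; rewrite eq_exp_mod1 // -mord_dvd.
have -> : (m %| t * Ssum o r * Ssum q (r ^ o)) = (m %| t * Ssum o r * q).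
  by rewrite /dvdn -modnMmr (Ssum_mod1 _ _ _ ro) modnMmr.
have co_g : coprime (m %/ g) (t * Ssum o r %/ g).
  by rewrite /coprime -(eqn_pmul2l g0) muln_gcdr muln1 ![g * _]mulnC !divnK.
rewrite -{2}(divnK gm) -[t * _ in RHS](divnK gS) mulnAC dvdn_pmul2r //.
by rewrite Gauss_dvdr.
Qed.

Lemma kappa_gt0 m r t : 0 < m -> 0 < r -> coprime r m -> 0 < kappa m r t.
Proof.
move=> m0 r0 co; rewrite /kappa divn_gt0 ?gcdn_gt0 ?m0 //.
by rewrite dvdn_leq ?muln_gt0 ?m0 ?mord_gt0 // dvdn_mulr ?dvdn_gcdl.
Qed.

(** In [kappa d r t] the shift enters only through a gcd with d, a divisor of n. This is what later
    groups the shifts t by gcd(t, n). *)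
Lemma kappa_gcdn n d r t : d %| n -> kappa d r (gcdn t n) = kappa d r t.
Proof.
move=> dn; rewrite /kappa; congr (_ %/ _).
by rewrite muln_gcdl gcdnCA (gcdn_idPl (dvdn_mulr _ dn)) gcdnC.
Qed.

Lemma kappa_dvdn d n r t :
  0 < n -> 0 < r -> coprime r n -> d %| n -> kappa d r t %| kappa n r t.
Proof.
move=> n0 r0 co dn; have d0 := dvdn_gt0 n0 dn.
have := kappa_dvd n r t (kappa n r t) n0 r0 co; rewrite dvdnn => /esym/andP[H1 H2].
rewrite kappa_dvd ?(coprime_dvdr dn) //.
by rewrite !(dvdn_trans dn).
Qed.

(* Let [a : j |-> r j + t] on Z/n, which has order [kappa n r t].  Under these
   hypotheses [a ^ k] has a fixed point, so it is conjugate to multiplication by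
   [r ^ k] and its order divides that of [r ^ k]. *)
Lemma kappa_dvd_lcm n r t d k L :
  0 < n -> 0 < r -> coprime r n -> kappa d r t %| k -> k %| L ->
  mord n r %| L -> gcdn (r ^ k - 1) n = d -> kappa n r t %| L.
Proof.
move=> n0 r0 co kd /dvdnP[q ->] oL gd.
have dn : d %| n by rewrite -gd dvdn_gcdr.
have d0 := dvdn_gt0 n0 dn.
move: kd; rewrite kappa_dvd ?(coprime_dvdr dn) // => /andP[_ dS].
rewrite kappa_dvd // -mord_dvd // oL /= [q * k]mulnC SsumM mulnA.
(* As d | t S_k(r), it suffices that n | d S_q(r^k). With d = gcd(r^k - 1, n) this follows from (r^k
   - 1) S_q(r^k) = r^(k q) - 1. *)
apply: (@dvdn_trans (d * Ssum q (r ^ k))); last by rewrite dvdn_mul.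
rewrite -gd muln_gcdl dvdn_gcd (dvdn_mulr _ (dvdnn n)) andbT.
by rewrite -SsumE ?expn_gt0 ?r0 // -expnM mulnC -mord_dvd.
Qed.

(** A divisor g of n divides r^k - 1 iff |r|_g divides k, and |r|_g divides |r|_n; hence only gcd(k,
    |r|_n) matters. *)
Lemma gcdn_exp_sub1 n r k k' :
  0 < n -> 0 < r -> coprime r n -> gcdn k (mord n r) = gcdn k' (mord n r) ->
  gcdn (r ^ k - 1) n = gcdn (r ^ k' - 1) n.
Proof.
move=> n0 r0 co; wlog suff: k k' / gcdn k (mord n r) = gcdn k' (mord n r) ->
    gcdn (r ^ k - 1) n %| gcdn (r ^ k' - 1) n.
  by move=> H E; apply/eqP; rewrite eqn_dvd !H.
move=> E; rewrite dvdn_gcd dvdn_gcdr andbT; set g := gcdn _ n.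
have gn : g %| n by apply: dvdn_gcdr.
have g0 := dvdn_gt0 n0 gn.
have cog := coprime_dvdr gn co.
rewrite -mord_dvd //; apply: dvdn_trans (dvdn_gcdl k' (mord n r)).
by rewrite -E dvdn_gcd mord_dvd ?dvdn_gcdl // mord_dvdn.
Qed.

(** The multiples of [kappa d r t] are indexed by j, and the condition depends on j only through
    gcd(j, M); [sum_gcdn] then collects the j with the same gcd l. *)
Lemma sum_multiples_gcd_exp n r t d :
  0 < n -> 0 < r -> coprime r n -> d %| n ->
  let M := mord n r %/ gcdn (kappa d r t) (mord n r) in
  \sum_(k < kappa n r t | kappa d r t %| k) (gcdn (r ^ k - 1) n == d) =
  \sum_(l <- divisors M | gcdn (r ^ (l * kappa d r t) - 1) n == d)
    totient (M %/ l).
Proof.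
move=> n0 r0 co dn M; have d0 := dvdn_gt0 n0 dn.
have cod := coprime_dvdr dn co.
set kd := kappa d r t in M *; set kn := kappa n r t; set o := mord n r in M *.
have kd0 : 0 < kd by apply: kappa_gt0.
have kn0 : 0 < kn by apply: kappa_gt0.
have o0 : 0 < o by apply: mord_gt0.
have go : gcdn kd o %| o by apply: dvdn_gcdr.
have M0 : 0 < M by rewrite divn_gt0 ?gcdn_gt0 ?kd0 // dvdn_leq.
have oL : o %| kd * M.
  by rewrite -[X in X %| _](divnK go) mulnC dvdn_mul ?dvdn_gcdl.
(* [kd * M] is lcm(kd, o), and both kd and o divide kn. *)
have Ln : kd * M %| kn.
  rewrite /M muln_divA // -/(lcmn kd o) dvdn_lcm kappa_dvdn //=.
  by rewrite mord_dvd //; have := kappa_dvd n r t kn n0 r0 co; rewrite dvdnn => /esym/andP[].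
pose G j := gcdn (r ^ (j * kd) - 1) n == d.
have Gper j : G j = G (gcdn j M).
  congr (_ == _); apply: gcdn_exp_sub1 => //; rewrite -/o.
  rewrite muln_gcdl -gcdnA [M * _]mulnC.
  by congr (gcdn _ _); apply/esym/gcdn_idPr.
have /dvdnP[q knE] : kd %| kn by apply: kappa_dvdn.
have -> : \sum_(k < kn | kd %| k) (gcdn (r ^ k - 1) n == d) = \sum_(j < q) G j.
  rewrite knE mulnC (sum_multiples _ _ (fun k => nat_of_bool (gcdn (r ^ k - 1) n == d))) //.
  by apply: eq_bigr => j _; rewrite /G mulnC.
(* If no l satisfies the condition, both sides vanish; the range q of j is identified with M only in
   the other case. *)
rewrite -/G; case: (boolP (has G (divisors M))) => [/hasP[l] | /hasPn noG]; last first.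
  rewrite big1 => [|j _]; last first.
    by rewrite Gper (negPf (noG _ _)) // -dvdn_divisors ?dvdn_gcdr.
  by rewrite big_seq_cond big1 // => l /andP[lM Gl]; have := noG l lM; rewrite /G Gl.
rewrite -dvdn_divisors // => lM /eqP Gl.
(* The contributing l gives kn | lcm(kd, o) by [kappa_dvd_lcm]; with [Ln] this forces equality. *)
have -> : q = M.
  apply/eqP; rewrite -(@eqn_pmul2l kd) // mulnC -knE eqn_dvd Ln andbT.
  apply: (@kappa_dvd_lcm n r t d (l * kd)) => //; first exact: dvdn_mull.
  by rewrite mulnC dvdn_mul.
rewrite (eq_bigr (fun j : 'I_M => nat_of_bool (G (gcdn j M)))) => [|j _]; last first.
  by rewrite -Gper.
rewrite (sum_gcdn nat M (fun l => nat_of_bool (G l))) // [RHS]big_mkcond.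
by apply: eq_bigr => i _; rewrite natn -/(G i); case: (G i); rewrite (mulr1, mulr0).
Qed.

(** * Affine maps on Z/n and the cycles of a_{n,r,t} on U_n and V_n *)

Local Open Scope ring_scope.

Lemma natr_Zp_eq0 n a : (1 < n)%N -> (a%:R == 0 :> 'Z_n) = (n %| a)%N.
Proof. by move=> n1; rewrite -val_eqE /= val_Zp_nat. Qed.

Lemma Zp_affine_fixed n a b (x : 'Z_n) : (1 < n)%N -> (0 < a)%N ->
  (a%:R * x + b%:R == x) = (n %| (a - 1) * x + b)%N.
Proof.
move=> n1 a0; rewrite -natr_Zp_eq0 // -subr_eq0 natrD natrM natrB // natr_Zp.
by rewrite mulrBl mul1r addrAC.
Qed.

Lemma big_Zp n (R : Type) (idx : R) (op : R -> R -> R) (P : pred nat) (F : nat -> R) :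
  (1 < n)%N -> \big[op/idx]_(x : 'Z_n | P x) F x = \big[op/idx]_(x < n | P x) F x.
Proof. by move=> n1; rewrite -!(big_mkord P) Zp_cast. Qed.

Lemma big_dih_V n (R : Type) (idx : R) (op : Monoid.com_law idx) (F : dih n -> R) :
  \big[op/idx]_(x in dih_V n) F x = \big[op/idx]_(j : 'Z_n) F (j, true).
Proof.
rewrite (reindex_onto (fun j : 'Z_n => (j, true) : dih n) fst) /=.
  by apply: eq_bigl => j; rewrite inE eqxx.
by case=> j b; rewrite inE /= => ->.
Qed.

Lemma big_dih_U n (R : Type) (idx : R) (op : Monoid.com_law idx) (F : dih n -> R) :
  \big[op/idx]_(x in dih_U n) F x = \big[op/idx]_(j : 'Z_n | j != 0) F (j, false).
Proof.
rewrite (reindex_onto (fun j : 'Z_n => (j, false) : dih n) fst) /=.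
  by apply: eq_bigl => j; rewrite inE /= eqxx andbT.
by case=> j b; rewrite inE /= => /andP[/eqP->].
Qed.

Section DihAffine.
Variables n r t : nat.
Hypotheses (n_gt1 : (1 < n)%N) (r_gt0 : (0 < r)%N) (co_rn : coprime r n).

Let n_gt0 : (0 < n)%N := ltnW n_gt1.

Let r_unit : (r%:R : 'Z_n) \is a GRing.unit.
Proof. by rewrite unitZpE // coprime_sym. Qed.

Lemma iter_dih_a k (x : dih n) :
  iter k (dih_a r t) x =
  ((r ^ k)%:R * x.1 + (if x.2 then (t * Ssum k r)%:R else 0), x.2).
Proof.
elim: k => [|k IH] /=; first by rewrite /Ssum big_ord0 muln0 mul1r if_same addr0; case: x.
rewrite IH /dih_a /=; congr (_, _); rewrite mulrDr mulrA -natrM -expnS -addrA.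
congr (_ + _); case: ifP => _; last by rewrite mulr0 addr0.
rewrite -natrM -natrD /Ssum big_ord_recl /= mulnDr muln1 addnC mulnCA; congr (_ + _ * _)%N%:R.
by rewrite big_distrr; apply: eq_bigr => i _; rewrite /= -expnS.
Qed.

Lemma dih_a_inj : injective (@dih_a n r t).
Proof.
move=> [i b] [j c] E; have /= E2 := congr1 snd E; have /= E1 := congr1 fst E.
rewrite -{c E}E2 in E1 *; congr (_, _).
by apply: (mulrI r_unit); apply: addIr E1.
Qed.

Lemma fclosed_dih_V : fclosed (@dih_a n r t) (dih_V n).
Proof. by move=> x _ /eqP <-; rewrite !inE. Qed.

Lemma fclosed_dih_U : fclosed (@dih_a n r t) (dih_U n).
Proof.
move=> [i b] _ /eqP <-; rewrite !inE /=; case: b => //=.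
by rewrite addr0 -[in RHS](mulr0 r%:R) (inj_eq (mulrI r_unit)).
Qed.

(** r^k x = x in Z/n iff n / gcd(x, n), the additive order of x, divides r^k - 1; thus both sides
    have the same multiples. *)
Lemma order_dih_a_U (x : 'Z_n) :
  fingraph.order (dih_a r t) ((x, false) : dih n) = mord (n %/ gcdn x n) r.
Proof.
have dvdE k : (fingraph.order (dih_a r t) ((x, false) : dih n) %| k)%N =
              (mord (n %/ gcdn x n) r %| k)%N.
  have gn : (gcdn x n %| n)%N by apply: dvdn_gcdr.
  have g0 := dvdn_gt0 n_gt0 gn.
  rewrite -iter_eq_dvd_order; last exact: dih_a_inj.
  have rk0 : (0 < r ^ k)%N by rewrite expn_gt0 r_gt0.
  have fixE := Zp_affine_fixed n (r ^ k) 0 x n_gt1 rk0.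
  rewrite mulr0n addn0 in fixE.
  rewrite iter_dih_a /= xpair_eqE eqxx andbT fixE.
  have d0 : (0 < n %/ gcdn x n)%N by rewrite divn_gt0 // dvdn_leq.
  have co_d : coprime r (n %/ gcdn x n) by apply: coprime_dvdr (dvdn_div gn) co_rn.
  rewrite (mord_dvd _ _ d0 r_gt0 co_d) -[RHS](@dvdn_pmul2r _ _ _ g0) (divnK gn).
  by rewrite muln_gcdr dvdn_gcd (dvdn_mull _ (dvdnn n)) andbT.
by apply/eqP; rewrite eqn_dvd dvdE dvdnn -dvdE dvdnn.
Qed.

(** Pairs (k, x) with k < K and a^k x = x are counted twice: a point in a cycle of length o accounts
    for K / o of them, and each k for the solutions of a linear congruence. *)
Lemma ncycles_V_nat :
  (ncycles (dih_V n) (@dih_a n r t) * kappa n r t =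
   \sum_(k < kappa n r t)
     if gcdn (r ^ k - 1) n %| t * Ssum k r then gcdn (r ^ k - 1) n else 0)%N.
Proof.
set K := kappa n r t; have K0 : (0 < K)%N by apply: kappa_gt0.
apply/eqP; rewrite -(Num.Theory.eqr_nat rat) natrM /ncycles.
rewrite fcard_sum_order ?big_distrl /=; [| exact: dih_a_inj | exact: fclosed_dih_V].
apply/eqP; transitivity
  (\sum_(x in dih_V n) (\sum_(k < K) (iter k (dih_a r t) x == x))%N%:R : rat).
  apply: eq_bigr => x; rewrite inE => xV.
  set o := fingraph.order _ _.
  have o0 : (0 < o)%N by apply: fingraph.order_gt0.
  (* K is the order of the affine map, so a^K fixes every point of V_n. *)
  have /dvdnP[q Kq] : (o %| K)%N.
    rewrite -iter_eq_dvd_order; last exact: dih_a_inj.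
    case: x xV {o o0} => j b /= ->; rewrite iter_dih_a xpair_eqE eqxx andbT.
    rewrite Zp_affine_fixed ?expn_gt0 ?r_gt0 //.
    have := kappa_dvd n r t K n_gt0 r_gt0 co_rn; rewrite dvdnn => /esym/andP[H1 H2].
    by rewrite dvdn_add // dvdn_mulr.
  have -> : (\sum_(k < K) (iter k (dih_a r t) x == x) = q)%N.
    rewrite (eq_bigr (fun k : 'I_K => if o %| k then 1 else 0))%N => [|k _]; last first.
      rewrite iter_eq_dvd_order //; exact: dih_a_inj.
    rewrite -big_mkcond Kq mulnC (sum_multiples _ _ (fun=> 1%N)) //.
    by rewrite sum1_card card_ord.
  rewrite Kq natrM mulrCA mulVf ?mulr1 //.
  by rewrite Num.Theory.pnatr_eq0 -lt0n.
rewrite -natr_sum exchange_big; congr _%:R; apply: eq_bigr => k _ /=.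
rewrite big_dih_V -card_linear_congruence //.
rewrite -(big_Zp n _ _ _ xpredT (fun j => nat_of_bool (n %| (r ^ k - 1) * j + t * Ssum k r)%N)) //.
apply: eq_bigr => j _.
by rewrite iter_dih_a xpair_eqE eqxx andbT Zp_affine_fixed ?expn_gt0 ?r_gt0.
Qed.

(** The exponents k are sorted by d = gcd(r^k - 1, n). Since d | r^k - 1 already holds, the
    fixed-point condition d | t S_k(r) amounts to [kappa d r t %| k]. *)
Lemma ncycles_V :
  (ncycles (dih_V n) (@dih_a n r t))%:R =
  \sum_(d <- divisors n)
    \sum_(l <- divisors (mord n r %/ gcdn (kappa d r t) (mord n r))
          | (gcdn (r ^ (l * kappa d r t) - 1) n == d)%N)
      (d%:R / (kappa n r t)%:R) *
      (totient (mord n r %/ (l * gcdn (kappa d r t) (mord n r))))%N%:R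
  :> rat.
Proof.
have K0 : (0 < kappa n r t)%N by apply: kappa_gt0.
have K0' : (kappa n r t)%:R != 0 :> rat by rewrite Num.Theory.pnatr_eq0 -lt0n.
apply: (mulIf K0'); rewrite -natrM ncycles_V_nat.
have -> : (\sum_(k < kappa n r t)
     (if gcdn (r ^ k - 1) n %| t * Ssum k r then gcdn (r ^ k - 1) n else 0) =
   \sum_(d <- divisors n) d *
     \sum_(k < kappa n r t | kappa d r t %| k) (gcdn (r ^ k - 1) n == d))%N.
  under [RHS]eq_bigr => d _ do rewrite big_mkcond big_distrr /=.
  rewrite exchange_big; apply: eq_bigr => k _ /=.
  set g := gcdn _ n; have gn : (g %| n)%N by apply: dvdn_gcdr.
  rewrite (bigD1_seq g) ?divisors_uniq -?dvdn_divisors //= eqxx.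
  rewrite big1_seq ?addn0 => [|d /andP[/negPf gd _]]; last first.
    by rewrite eq_sym gd if_same muln0.
  rewrite kappa_dvd ?(dvdn_gt0 n_gt0 gn) ?(coprime_dvdr gn) //.
  by rewrite dvdn_gcdl /=; case: ifP; rewrite (muln1, muln0).
rewrite natr_sum big_distrl; apply: eq_big_seq => d /=; rewrite -dvdn_divisors // => dn.
rewrite sum_multiples_gcd_exp // natrM natr_sum !big_distrr big_distrl /=.
apply: eq_bigr => l _; rewrite mulrAC divfK //.
by rewrite -divnMA mulnC.
Qed.
End DihAffine.

Lemma reindex_divisors_div n (R : nmodType) (H : nat -> R) :
  (0 < n)%N -> \sum_(d <- divisors n) H (n %/ d)%N = \sum_(d <- divisors n) H d.
Proof.
move=> n0; rewrite -(big_map (fun d => n %/ d)%N xpredT H); apply: perm_big.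
have divK : {in divisors n, cancel (divn n) (divn n)}.
  by move=> d; rewrite -dvdn_divisors // => dn; rewrite divnA // mulKn.
apply: uniq_perm; rewrite ?divisors_uniq //.
  by rewrite map_inj_in_uniq ?divisors_uniq //; apply: can_in_inj divK.
move=> d; apply/mapP/idP => [[e + ->] | dn].
  by rewrite -!dvdn_divisors // => /dvdn_div.
exists (n %/ d)%N; last by rewrite divK.
by move: dn; rewrite -!dvdn_divisors // => /dvdn_div.
Qed.

Lemma ncycles_U n r t :
  (1 < n)%N -> (0 < r)%N -> coprime r n ->
  (ncycles (dih_U n) (@dih_a n r t))%:R =
    \sum_(d <- divisors n | (1 < d)%N) (totient d)%:R / (mord d r)%:R :> rat.
Proof.
move=> n1 r0 co; have n0 := ltnW n1.
rewrite /ncycles fcard_sum_order; [| exact: dih_a_inj | exact: fclosed_dih_U].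
rewrite big_dih_U.
under eq_bigr => x _ do rewrite order_dih_a_U //.
rewrite (eq_bigl (fun x : 'Z_n => nat_of_ord x != 0%N)) //.
rewrite (big_Zp n _ _ _ (fun x => x != 0%N) (fun x => (mord (n %/ gcdn x n) r)%:R^-1)) //.
(* The value 0 covers d = n, that is x = 0, which is outside U_n. *)
pose G d : rat := if (1 < n %/ d)%N then (mord (n %/ d) r)%:R^-1 else 0.
rewrite big_mkcond (eq_bigr (fun x : 'I_n => G (gcdn x n))) => [|x _]; last first.
  rewrite /G; have gn := dvdn_gcdr x n.
  have g0 : (0 < gcdn x n)%N := dvdn_gt0 n0 gn.
  rewrite ltn_divRL // mul1n ltn_neqAle dvdn_leq // andbT.
  suff -> : (gcdn x n != n) = (x != 0%N :> nat) by [].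
  apply: congr1; apply/eqP/eqP => [E | ->]; last by rewrite gcd0n.
  have := dvdn_gcdl x n; rewrite E => nx.
  by apply/eqP; rewrite -leqn0 leqNgt; apply/negP => /dvdn_leq/(_ nx); rewrite leqNgt ltn_ord.
rewrite sum_gcdn // [RHS]big_mkcond /=.
rewrite -[RHS](reindex_divisors_div n _
  (fun d => if (1 < d)%N then (totient d)%:R / (mord d r)%:R else 0)) //.
by apply: eq_bigr => d _; rewrite /G; case: ifP; rewrite ?mulr0.
Qed.

Lemma ncycles_U_shift n r t :
  (1 < n)%N -> (0 < r)%N -> coprime r n ->
  ncycles (dih_U n) (@dih_a n r t) = ncycles (dih_U n) (@dih_a n r 0).
Proof.
move=> n1 r0 co; apply/eqP; rewrite -(Num.Theory.eqr_nat rat); apply/eqP.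
exact: etrans (ncycles_U n r t n1 r0 co) (esym (ncycles_U n r 0 n1 r0 co)).
Qed.

Lemma ncycles_V_gcdn n r t :
  (1 < n)%N -> (0 < r)%N -> coprime r n ->
  ncycles (dih_V n) (@dih_a n r t) = ncycles (dih_V n) (@dih_a n r (gcdn t n)).
Proof.
move=> n1 r0 co; apply/eqP; rewrite -(Num.Theory.eqr_nat rat); apply/eqP.
apply: etrans (ncycles_V n r t n1 r0 co) _.
apply/esym; apply: etrans (ncycles_V n r (gcdn t n) n1 r0 co) _; apply/esym.
apply: eq_big_seq => d; rewrite -dvdn_divisors ?(ltnW n1) // => dn.
by rewrite (kappa_gcdn n d r t dn) (kappa_gcdn n n r t (dvdnn n)).
Qed.

(** * Cayley digraphs and orbits of connection sets in any finite group *)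

Section CayleyOrbits.
Variable gT : finGroupType.
Local Open Scope group_scope.
Implicit Types (S : {set gT}) (s : {perm gT}).

Lemma autM s : s \in Aut [set: gT] -> {morph s : x y / x * y}.
Proof.
by rewrite inE => /andP[_ /morphicP sM] x y; apply: sM; rewrite inE.
Qed.

Lemma aut1 s : s \in Aut [set: gT] -> s 1 = 1.
Proof. by move=> /autM sM; apply: (mulgI (s 1)); rewrite -sM !mulg1. Qed.

Lemma conn_setsE S : (S \in conn_sets gT) = (1 \notin S).
Proof. by rewrite powersetE subsetC sub1set inE. Qed.

Lemma conn_sets_aut s S :
  s \in Aut [set: gT] -> (s @: S \in conn_sets gT) = (S \in conn_sets gT).
Proof.
by move=> sA; rewrite !conn_setsE -{1}(aut1 _ sA) (mem_imset _ _ perm_inj).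
Qed.

Lemma cay_iso_aut s S : s \in Aut [set: gT] -> cay_iso S (s @: S).
Proof.
move=> sA; apply/existsP; exists s; apply/forallP => x; apply/forallP => y.
apply/eqP; apply/existsP/existsP => [[z /andP[zS /eqP->]] | [z /andP[]]].
  by exists (s z); rewrite imset_f //= autM.
case/imsetP=> w wS ->; rewrite -autM // (inj_eq perm_inj) => E.
by exists w; rewrite wS.
Qed.

(** An orbit always lies inside an isomorphism class; the DCI property is the converse inclusion. *)
Lemma n_cay_classes_DCI : DCI_group gT -> n_cay_classes gT = n_aut_orbits gT.
Proof.
move=> dci; congr #|pred_of_set _|; apply: eq_in_imset => S Sc.
apply/setP => T; rewrite inE; apply/andP/imsetP => [[Tc iso] | [s sA ->]].
  by have [s sA <-] := dci S T Sc Tc iso; exists s.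
by rewrite conn_sets_aut // cay_iso_aut.
Qed.

(** Burnside's lemma for the action on sets: those fixed by s are unions of cycles of s away from
    1. *)
Lemma n_aut_orbits_Burnside :
  (n_aut_orbits gT * #|Aut [set: gT]| =
   \sum_(s in Aut [set: gT]) 2 ^ fcard s (~: [set 1%g : gT]))%N.
Proof.
have acts : [acts Aut [set: gT], on conn_sets gT | 'P^*].
  apply/actsP; rewrite ?subsetT // => s sA S /=.
  by rewrite -(conn_sets_aut s S sA).
have := Frobenius_Cauchy acts.
have -> : #|[set orbit 'P^* (Aut [set: gT]) S | S in conn_sets gT]| = n_aut_orbits gT.
  by [].
move=> <-; apply: eq_bigr => s sA.
rewrite -card_invariant_subsets; [| exact: perm_inj | ].
  apply: eq_card => S; rewrite !inE.
  by apply: andb_id2l => _; rewrite sub1set inE.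
move=> x _ /eqP <-; rewrite !inE -{2}(aut1 _ sA).
by rewrite (inj_eq perm_inj).
Qed.
End CayleyOrbits.

Lemma n_compU (T : finType) (e : rel T) (A B : {set T}) :
  [disjoint A & B] -> n_comp e (A :|: B) = (n_comp e A + n_comp e B)%N.
Proof.
move=> dAB; rewrite /n_comp_mem -cardUI.
rewrite [X in (_ + X)%N]eq_card0 ?addn0.
  by apply: eq_card => x; rewrite !inE -andb_orr.
move=> x; rewrite !inE; apply/negP => /andP[/andP[_ xA] /andP[_ xB]].
by move: (disjointFr dAB xA); rewrite xB.
Qed.

(** * Automorphisms of D_2n and the orbit count *)

Section DihAut.
Variable n : nat.
Hypothesis n_gt2 : (2 < n)%N.
Let n_gt1 : (1 < n)%N := ltnW n_gt2.

Lemma dih_mulE (x y : dih n) :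
  (x * y)%g = (x.1 + (if x.2 then - y.1 else y.1), x.2 (+) y.2).
Proof. by []. Qed.

Lemma dih_uX k : (dih_u n ^+ k)%g = (k%:R, false) :> dih n.
Proof. by elim: k => // k IH; rewrite expgS IH dih_mulE /= -natr1 addrC. Qed.

Lemma dih_uv (x : dih n) :
  x = (dih_u n ^+ x.1 * (if x.2 then dih_v n else 1))%g.
Proof.
rewrite dih_uX dih_mulE /= natr_Zp; case: x => i [] /=; last by rewrite addr0.
by rewrite addr0.
Qed.

Lemma dih_a_morph r t : {morph @dih_a n r t : x y / (x * y)%g}.
Proof.
move=> [i b] [j c]; rewrite !dih_mulE /dih_a /=; congr (_, _).
case: b; case: c => /=; rewrite ?addr0 ?mulrDr ?mulrN //.
- by rewrite opprD addrACA subrr addr0.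
- by rewrite addrAC.
- by rewrite addrA.
Qed.

Lemma mem_Aut_dih_a (s : {perm dih n}) r t : s =1 dih_a r t -> s \in Aut [set: dih n].
Proof.
move=> sE; rewrite inE; apply/andP; split; first by apply/subsetP => x; rewrite inE.
by apply/morphicP => x y _ _; rewrite !sE dih_a_morph.
Qed.

(** An automorphism is determined by the images of u and v, which must be a generating rotation and
    a reflection. *)
Lemma dih_autE (s : {perm dih n}) :
  s \in Aut [set: dih n] ->
  coprime (s (dih_u n)).1 n /\ s =1 dih_a (s (dih_u n)).1 (s (dih_v n)).1.
Proof.
move=> sA; have sM := autM _ _ sA; have s1 := aut1 _ _ sA.
have sX k x : s (x ^+ k)%g = (s x ^+ k)%g.
  by elim: k => [|k IH]; rewrite ?expg0 // !expgS sM IH.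
have su : s (dih_u n) = ((s (dih_u n)).1, false).
  (* Were s(u) a reflection, u^2 would map to 1, which n > 2 excludes. *)
  case E : (s (dih_u n)) => [i []] //=.
  have : s (dih_u n ^+ 2)%g = s 1%g.
    by rewrite sX E s1 expgS expg1 dih_mulE /= subrr.
  move/perm_inj; rewrite dih_uX => /(congr1 fst) /= /eqP.
  by rewrite natr_Zp_eq0 // => /(dvdn_leq (ltn0Sn 1)); rewrite leqNgt n_gt2.
have suX k : s (dih_u n ^+ k)%g = (k%:R * (s (dih_u n)).1, false).
  rewrite sX {1}su; elim: k => [|k IH]; first by rewrite mul0r.
  by rewrite expgS IH dih_mulE /= -natr1 mulrDl mul1r addrC.
have sv : s (dih_v n) = ((s (dih_v n)).1, true).
  (* Were s(v) a rotation, every value of s would be one, but v is a value. *)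
  case E : (s (dih_v n)) => [j []] //=; exfalso.
  have : (s ((s^-1)%g (dih_v n))).2 = true by rewrite permKV.
  rewrite [(s^-1)%g _]dih_uv sM suX dih_mulE /=.
  by case: ifP; rewrite ?E ?s1.
split.
  (* The preimage w of u is a rotation, and its exponent is an inverse of r mod n. *)
  have := permKV s (dih_u n); set w := (s^-1)%g _.
  rewrite [w]dih_uv sM suX dih_mulE; set i := (s (dih_u n)).1.
  case: w.2 => /= E; first by have := congr1 snd E; rewrite sv.
  have {E} /= := congr1 fst E; rewrite s1 addr0 => E.
  rewrite coprime_sym -unitZpE // natr_Zp.
  by apply/unitrPr; exists w.1; rewrite mulrC -[w.1]natr_Zp.
move=> x; rewrite {1}[x]dih_uv sM suX dih_mulE /dih_a !natr_Zp /=.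
rewrite mulrC; case: (x.2); first by rewrite sv.
by rewrite s1.
Qed.

(** Recording the exponents of s(u) and s(v) is injective by [dih_autE], and every pair (r, t) with
    r coprime to n arises from a_{n,r,t}. *)
Lemma sum_Aut_dih (F : nat -> nat -> nat) :
  (\sum_(s in Aut [set: dih n]) F (s (dih_u n)).1 (s (dih_v n)).1 =
   \sum_(r < n | coprime r n) \sum_(t < n) F r t)%N.
Proof.
pose p (s : {perm dih n}) : 'Z_n * 'Z_n := ((s (dih_u n)).1, (s (dih_v n)).1).
have injp : {in Aut [set: dih n] &, injective p}.
  move=> s s' /dih_autE[_ sE] /dih_autE[_ sE'] E; apply/permP => x.
  rewrite sE sE'; have /= -> := congr1 fst E; by have /= -> := congr1 snd E.
transitivity (\sum_(y in p @: Aut [set: dih n]) F y.1 y.2)%N.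
  by rewrite big_imset.
transitivity (\sum_(y : 'Z_n * 'Z_n | coprime y.1 n) F y.1 y.2)%N.
  apply: eq_bigl => -[r t] /=; apply/imsetP/idP => [[s /dih_autE[co _] [-> _]] // | co].
  have r0 : (0 < r)%N.
    by rewrite lt0n; apply: contraTneq co => ->; rewrite /coprime gcd0n gtn_eqF.
  exists (perm (dih_a_inj n r t n_gt1 co)).
    by apply: (mem_Aut_dih_a _ r t) => x; rewrite permE.
  rewrite /p !permE /dih_a /= mulr1 addr0 mulr0 add0r.
  by rewrite !natr_Zp.
transitivity (\sum_(r : 'Z_n | coprime r n) \sum_(t : 'Z_n) F r t)%N.
  by rewrite pair_big_dep; apply: eq_bigl => y; rewrite andbT.
rewrite (big_Zp n _ _ _ (fun r => coprime r n) (fun r => \sum_(t : 'Z_n) F r t)%N) //.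
by apply: eq_bigr => r _; rewrite (big_Zp n _ _ _ xpredT).
Qed.

Lemma card_Aut_dih : #|Aut [set: dih n]| = (n * totient n)%N.
Proof.
rewrite -sum1_card (sum_Aut_dih (fun _ _ => 1%N)).
under eq_bigr => r _ do rewrite sum1_card card_ord.
rewrite sum_nat_const mulnC; congr (_ * _)%N.
rewrite totient_count_coprime big_mkord -sum1_card big_mkcond /=.
by apply: eq_bigr => i _; rewrite [coprime n i]coprime_sym.
Qed.

Lemma n_aut_orbits_dih :
  (n_aut_orbits (dih n) * (n * totient n) =
   \sum_(t <- divisors n) totient (n %/ t) *
     \sum_(1 <= r < n | coprime r n)
       2 ^ (ncycles (dih_U n) (@dih_a n r 0) + ncycles (dih_V n) (@dih_a n r t)))%N.
Proof.
pose H r t := (2 ^ (ncycles (dih_U n) (@dih_a n r 0) + ncycles (dih_V n) (@dih_a n r t)))%N.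
have r_gt0 r : coprime r n -> (0 < r)%N.
  by case: r => //; rewrite /coprime gcd0n gtn_eqF.
rewrite -card_Aut_dih n_aut_orbits_Burnside.
transitivity (\sum_(s in Aut [set: dih n]) H (s (dih_u n)).1 (s (dih_v n)).1)%N.
  apply: eq_bigr => s /dih_autE[]; set r : nat := (s _).1; set t : nat := (s _).1.
  move=> co sE; rewrite /H -(ncycles_U_shift n r t n_gt1 (r_gt0 r co) co).
  (* U_n and V_n partition the non-identity elements, so the cycle counts add. *)
  rewrite (eq_fcard sE) -n_compU; last first.
    by rewrite -setI_eq0; apply/eqP/setP => -[i []]; rewrite !inE ?andbF.
  congr (2 ^ _)%N; apply: eq_n_comp_r => -[i []]; rewrite !inE /= ?andbT ?orbF ?orbT.
  - by apply/eqP => /(congr1 snd).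
  - by rewrite xpair_eqE andbT.
rewrite sum_Aut_dih.
under [RHS]eq_bigr => t _ do rewrite big_geq_mkord big_distrr /=.
(* r = 0 is not coprime to n, so both ranges of r agree. *)
rewrite [RHS]exchange_big /=; apply: eq_big => [r | r co].
  by rewrite andb_idr // => /r_gt0.
transitivity (\sum_(t < n) H r (gcdn t n))%N.
  apply: eq_bigr => t _.
  by rewrite /H (ncycles_V_gcdn n r t n_gt1 (r_gt0 r co) co).
rewrite (sum_gcdn nat n (H r) (ltnW n_gt1)).
by apply: eq_bigr => d _; rewrite natn.
Qed.
End DihAut.

Theorem theorem4p5 (n : nat) :
  (2 < n)%N -> DCI_group (dih n) ->
  [/\ n_cay_classes (dih n) = n_aut_orbits (dih n),
      (n_aut_orbits (dih n))%:R =
        ((n * totient n)%N%:R)^-1 *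
        \sum_(t <- divisors n) (totient (n %/ t))%:R *
          \sum_(1 <= r < n | coprime r n)
             (2 ^ (ncycles (dih_U n) (@dih_a n r 0)
                   + ncycles (dih_V n) (@dih_a n r t)))%N%:R :> rat,
      forall r : nat, (1 <= r < n)%N -> coprime r n ->
        (ncycles (dih_U n) (@dih_a n r 0))%:R =
          \sum_(d <- divisors n | (1 < d)%N) (totient d)%:R / (mord d r)%:R :> rat
    & forall r t : nat, (1 <= r < n)%N -> coprime r n -> t \in divisors n ->
        (ncycles (dih_V n) (@dih_a n r t))%:R =
          \sum_(d <- divisors n)
            \sum_(l <- divisors (mord n r %/ gcdn (kappa d r t) (mord n r))
                  | (gcdn (r ^ (l * kappa d r t) - 1) n == d)%N)
              (d%:R / (kappa n r t)%:R) *
              (totient (mord n r %/ (l * gcdn (kappa d r t) (mord n r))))%N%:R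
          :> rat].
Proof.
move=> n_gt2 dci; have n_gt1 := ltnW n_gt2; split.
- exact: n_cay_classes_DCI.
- have N0 : (n * totient n)%N%:R != 0 :> rat.
    by rewrite Num.Theory.pnatr_eq0 -lt0n muln_gt0 totient_gt0 andbb ltnW.
  apply: (mulfI N0); rewrite mulVKf // mulrC -natrM n_aut_orbits_dih // natr_sum.
  by apply: eq_bigr => t _; rewrite natrM natr_sum.
- by move=> r /andP[r0 _] co; apply: ncycles_U.
- by move=> r t /andP[r0 _] co _; apply: ncycles_V.
Qed.
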